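(* Let $M$ be any minimal set of $\Sigma(n)$. The union of all minimal sets of $\Sigma(n)$ homeomorphic with $M$ is a dense subset of $\Sigma(n)$.
   Context: Let $\mathcal{A}_n=\{0,1,\dots,n-1\}$ and let $S(n)=(\mathcal{A}_n^{\mathbb{Z}},s)$ be the full two-sided shift on $\mathcal{A}_n$, with shift homeomorphism $s$. The suspension of a homeomorphism $h\colon X\to X$ is the quotient $X\times[0,1]/\!\sim$, where $(x,1)\sim(h(x),0)$, and the suspension flow on it is induced by translation on $[0,1]$. $\Sigma(n)$ denotes the suspension of $S(n)$, with its suspension flow. A minimal set of $\Sigma(n)$ is a (non-empty) closed set, invariant under the suspension flow, containing no proper, non-empty, closed invariant subset. *)

(* Defs.v *)
From HB Require Import structures.
From Stdlib Require Import Relation_Operators.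
From mathcomp Require Import all_boot all_order all_algebra.
From mathcomp Require Import all_classical all_reals topology normedtype.

Set Implicit Arguments.
Unset Strict Implicit.
Unset Printing Implicit Defensive.

Import Order.TTheory GRing.Theory Num.Theory.
Import numFieldNormedType.Exports.
Local Open Scope classical_set_scope.
Local Open Scope ring_scope.
Local Open Scope quotient_scope.

Record homeomorphism (X Y : topologicalType) := Homeomorphism {
  homeo_fun :> X -> Y;
  homeo_inv : Y -> X;
  homeo_funK : cancel homeo_fun homeo_inv;
  homeo_invK : cancel homeo_inv homeo_fun;
  homeo_fun_continuous : continuous homeo_fun;
  homeo_inv_continuous : continuous homeo_inv }.

Definition homeomorphic (X Y : topologicalType) : Prop :=
  inhabited (homeomorphism X Y).

Definition homeo_iter (X : topologicalType) (h : homeomorphism X X) (k : int) :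
    X -> X :=
  match k with
  | Posz m => iter m h
  | Negz m => iter m.+1 (homeo_inv h)
  end.

Lemma homeo_iterS (X : topologicalType) (h : homeomorphism X X) (k : int) x :
  homeo_iter h (k + 1) x = homeo_iter h k (h x).
Proof.
case: k => [m|[|m]].
- by rewrite -PoszD addn1 /homeo_iter iterSr.
- by rewrite /= homeo_funK.
- have -> : Negz m.+1 + 1 = Negz m by rewrite !NegzE -addn1 PoszD opprD addrNK.
  by rewrite /homeo_iter [in RHS]iterSr homeo_funK.
Qed.

Section Suspension.
Variables (R : realType) (X : topologicalType) (h : homeomorphism X X).

Definition unit_interval : set R := `[0, 1]%classic.

Definition cylinder : topologicalType := (X * set_type unit_interval)%type.

Definition glue (p q : cylinder) : Prop :=
  [/\ \val p.2 = 1, \val q.2 = 0 & q.1 = h p.1].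

Let suspension_rel' (p q : cylinder) : bool :=
  `[< clos_refl_sym_trans cylinder glue p q >].

Local Lemma suspension_rel_refl : reflexive suspension_rel'.
Proof. by move=> p; apply/asboolP; exact: rst_refl. Qed.

Local Lemma suspension_rel_sym : symmetric suspension_rel'.
Proof.
by move=> p q; apply/asboolP/asboolP => pq; exact: rst_sym.
Qed.

Local Lemma suspension_rel_trans : transitive suspension_rel'.
Proof.
move=> q p r /asboolP pq /asboolP qr; apply/asboolP.
exact: rst_trans pq qr.
Qed.

Definition suspension_rel :=
  EquivRel _ suspension_rel_refl suspension_rel_sym suspension_rel_trans.

Definition suspension := {eq_quot suspension_rel}.

HB.instance Definition _ :=
  Topological.copy suspension (quotient_topology suspension).
HB.instance Definition _ := Quotient.on suspension.

Lemma frac_part_unit (u : R) : u - (Num.floor u)%:~R \in unit_interval.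
Proof.
rewrite inE /unit_interval /= in_itv /= subr_ge0 ge_floor /=.
by rewrite lerBlDl -intrD1 ltW// floorD1_gt.
Qed.

Definition frac_part (u : R) : set_type unit_interval :=
  SigSub (frac_part_unit u).

(* Translating (x, s) by t and renormalizing the height s + t to [0, 1[:
   each time a full unit of height is crossed, h (or its inverse) is applied. *)
Definition cylinder_shift (t : R) (p : cylinder) : cylinder :=
  let u := \val p.2 + t in
  (homeo_iter h (Num.floor u) p.1, frac_part u).

Definition suspension_flow (t : R) (q : suspension) : suspension :=
  \pi_suspension (cylinder_shift t (repr q)).

(* The flow does not depend on the representatives chosen by repr. *)
Lemma suspension_flow_pi (t : R) (p : cylinder) :
  suspension_flow t (\pi_suspension p) = \pi_suspension (cylinder_shift t p).
Proof.
suff glueP q r : clos_refl_sym_trans cylinder glue q r ->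
    \pi_suspension (cylinder_shift t q) = \pi_suspension (cylinder_shift t r).
  apply: glueP; apply/asboolP.
  have /eqquotP// : repr (\pi_suspension p) = p %[mod suspension].
  by rewrite reprK.
elim=> {q r} [q r [q1 r0 rq]|//|q r _ -> //|q r s _ -> _ -> //].
congr (\pi_suspension _); rewrite /cylinder_shift q1 r0 rq add0r.
have fl : Num.floor (1 + t) = Num.floor t + 1.
  by rewrite addrC (floorDrz _ (rpred1 _)) floor1.
congr pair; first by rewrite fl homeo_iterS.
by apply: val_inj; rewrite /= fl intrD1 [1 + t]addrC opprD addrACA subrr addr0.
Qed.

(* Invariance is under the whole R-action, negative times included. *)
Definition flow_invariant (A : set suspension) : Prop :=
  forall t : R, suspension_flow t @` A = A.

Definition minimal_set (A : set suspension) : Prop :=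
  [/\ A !=set0, closed A, flow_invariant A &
      forall B : set suspension, B !=set0 -> closed B -> flow_invariant B ->
        B `<=` A -> B = A].

End Suspension.

Definition shift_space (n : nat) : topologicalType :=
  prod_topology (fun _ : int => discrete_topology 'I_n).

Definition shift_fun n (x : shift_space n) : shift_space n := fun i => x (i + 1).

Definition shift_inv n (x : shift_space n) : shift_space n := fun i => x (i - 1).

Lemma shift_funK n : cancel (@shift_fun n) (@shift_inv n).
Proof. by move=> x; apply/funext => i; rewrite /shift_inv /shift_fun subrK. Qed.

Lemma shift_invK n : cancel (@shift_inv n) (@shift_fun n).
Proof. by move=> x; apply/funext => i; rewrite /shift_inv /shift_fun addrK. Qed.

Lemma reindex_continuous n (f : int -> int) :
  continuous ((fun x i => x (f i)) : shift_space n -> shift_space n).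
Proof.
move=> x; have F := fmap_filter (fun (y : shift_space n) i => y (f i))
  (nbhs_filter x); apply/cvg_sup => i U [V] [[W oW <-] Wx WU]; apply: (filterS WU).
apply: (@proj_continuous int (fun=> discrete_topology 'I_n) (f i) x W).
exact: open_nbhs_nbhs.
Qed.

Definition shift n : homeomorphism (shift_space n) (shift_space n) :=
  Homeomorphism (@shift_funK n) (@shift_invK n)
    (@reindex_continuous n (fun i => i + 1))
    (@reindex_continuous n (fun i => i - 1)).

Definition Sigma (R : realType) (n : nat) : topologicalType :=
  suspension R (shift n).

(* Main.v *)
(**
Substituting a |-> u a for a fixed word u maps the full shift into itself, and,
running L = |u| + 1 times faster, induces a map F of Sigma(n) into itself with
F (flow_t q) = flow_(L t) (F q).  If u = w 0^m 1 with m >= L / 2, then the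
position of the blocks can be read off a substituted sequence: two copies of u
overlapping at an offset that is not a multiple of L would give u a period at
most L / 2, which the run 0^m followed by 1 excludes.  Hence F is injective,
and as Sigma(n) is compact Hausdorff, F carries a minimal set M to a minimal set
homeomorphic with M, all of whose symbol sequences contain the arbitrary word w.
For n <= 1 there is at most one sequence, and M itself meets every open set.
*)
From Stdlib Require Import Relation_Operators.
Require Import Defs.
From mathcomp Require Import all_boot all_order all_algebra.
From mathcomp Require Import all_classical all_reals topology normedtype.
From mathcomp Require Import zify ring lra.

Set Implicit Arguments.
Unset Strict Implicit.
Unset Printing Implicit Defensive.

Import Order.TTheory GRing.Theory Num.Theory.
Import numFieldNormedType.Exports.
Local Open Scope classical_set_scope.
Local Open Scope ring_scope.
Local Open Scope quotient_scope.

(** * Induction over the integers, continuity into products, iterates of a homeomorphism *)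

Lemma int_step_ind (P : int -> Prop) :
  P 0 -> (forall k, P k <-> P (k + 1)) -> forall k, P k.
Proof.
move=> P0 PS; elim/int_ind => // n.
  by move=> /PS; rewrite -addn1 PoszD.
by move=> Pn; apply/PS; rewrite -addn1 PoszD opprD addrNK.
Qed.

Lemma continuous_pair (X Y Z : topologicalType) (f : X -> Y) (g : X -> Z) :
  continuous f -> continuous g -> continuous (fun x => (f x, g x)).
Proof. by move=> cf cg x; apply: (cvg_pair (cf x) (cg x)). Qed.

Lemma continuous_fun_comp (X Y Z : topologicalType) (f : X -> Y) (g : Y -> Z) :
  continuous f -> continuous g -> continuous (fun x => g (f x)).
Proof. by move=> cf cg x; apply: (@continuous_comp _ _ _ f g) (cf x) (cg _). Qed.

Lemma continuous_fst (X Y : topologicalType) : continuous (@fst X Y).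
Proof. by move=> p; exact: cvg_fst. Qed.

Lemma continuous_snd (X Y : topologicalType) : continuous (@snd X Y).
Proof. by move=> p; exact: cvg_snd. Qed.

Section HomeoIter.
Variables (X : topologicalType) (h : homeomorphism X X).

Lemma homeo_iterD (k l : int) x :
  homeo_iter h (k + l) x = homeo_iter h k (homeo_iter h l x).
Proof.
move: l x; apply: int_step_ind => [x|l]; first by rewrite addr0.
split=> IH x; first by rewrite addrA !homeo_iterS IH.
by rewrite -[x](homeo_invK h) -!homeo_iterS -IH addrA.
Qed.

Lemma homeo_iter_continuous (k : int) : continuous (homeo_iter h k).
Proof.
have iter_continuous (f : X -> X) m : continuous f -> continuous (iter m f).
  move=> cf; elim: m => [|m IH] x; first exact: cvg_id.
  apply: (@continuous_comp _ _ _ (iter m f) f); [exact: IH|exact: cf].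
by case: k => m; apply: iter_continuous;
  [exact: homeo_fun_continuous|exact: homeo_inv_continuous].
Qed.

End HomeoIter.

(** * The suspension as a quotient of X * R *)

Section SuspensionPoint.
Variables (R : realType) (X : topologicalType) (h : homeomorphism X X).
Local Notation S := (suspension R h).

(* The point reached from the class of (x, 0) after time u. *)
Definition susp_point (x : X) (u : R) : S :=
  \pi_S (homeo_iter h (Num.floor u) x, frac_part u).

Lemma susp_pointDz x (u : R) (k : int) :
  susp_point x (u + k%:~R) = susp_point (homeo_iter h k x) u.
Proof.
rewrite /susp_point floorDrz ?intr_int// intrKfloor.
rewrite homeo_iterD; congr (\pi_S (_, _)); apply: val_inj => /=.
by rewrite floorDrz ?intr_int// intrKfloor intrD opprD addrACA subrr addr0.
Qed.

Lemma susp_point_pi (p : cylinder R X) :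
  \pi_S p = susp_point p.1 (\val p.2).
Proof.
case: p => x s /=; have := valP s; rewrite inE /unit_interval /= in_itv /=.
move=> /andP[s0]; rewrite le_eqVlt => /orP[/eqP s1|s1].
  (* Height 1 is the only one that [frac_part] changes; there one gluing step leads to (h x, 0). *)
  apply/eqquotP/asboolP/rst_step; split => //=.
    by rewrite s1 floor1 subrr.
  by rewrite s1 floor1.
have fl : Num.floor (\val s : R) = 0 by apply: floor_def; rewrite s0 add0r.
rewrite /susp_point fl; congr (\pi_S (_, _)); apply: val_inj => /=.
by rewrite fl subr0.
Qed.

Lemma susp_pointP (q : S) :
  exists x (u : R), [/\ 0 <= u, u < 1 & q = susp_point x u].
Proof.
have -> : q = susp_point (repr q).1 (\val (repr q).2).
  by rewrite -susp_point_pi reprK.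
set x := (repr q).1; set s : R := \val _.
exists (homeo_iter h (Num.floor s) x), (s - (Num.floor s)%:~R).
have /andP[fl fl1] := floor_itv s; rewrite intrD in fl1.
split; [by rewrite subr_ge0|by rewrite ltrBlDl|].
by rewrite -susp_pointDz subrK.
Qed.

Lemma flow_susp_point t x (u : R) :
  suspension_flow t (susp_point x u) = susp_point x (u + t).
Proof.
rewrite {1}/susp_point suspension_flow_pi.
rewrite -[LHS]/(susp_point _ (u - (Num.floor u)%:~R + t)) -susp_pointDz.
by congr susp_point; ring.
Qed.

(** [E] is the orbit relation of the Z-action (x, u) |-> (h^k x, u - k). It is an equivalence
    containing the gluing, hence contains the relation that the gluing generates. *)
Lemma susp_point_eq x y (u v : R) : susp_point x u = susp_point y v ->
  exists k : int, y = homeo_iter h k x /\ u = v + k%:~R.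
Proof.
pose E (p q : X * R) :=
  exists k : int, q.1 = homeo_iter h k p.1 /\ p.2 = q.2 + k%:~R.
have Erefl p : E p p by exists 0; rewrite addr0.
have Esym p q : E p q -> E q p.
  move=> [k [pq1 pq2]]; exists (- k); rewrite pq1 -homeo_iterD addNr.
  by rewrite pq2 rmorphN /= addrK.
have Etrans p q r : E p q -> E q r -> E p r.
  move=> [k [pq1 pq2]] [l [qr1 qr2]]; exists (l + k); split.
    by rewrite homeo_iterD -pq1.
  by rewrite pq2 qr2 intrD addrA.
pose c (p : cylinder R X) : X * R := (p.1, \val p.2).
have gluedE p q : clos_refl_sym_trans _ (@Defs.glue R X h) p q -> E (c p) (c q).
  elim=> {p q} [p q [p1 q0 pq]|p|p q _|p q r _ pq _];
    [|exact: Erefl|exact: Esym|exact: Etrans].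
  by exists 1; rewrite /= q0 p1 pq add0r.
have norm z w : E (z, w) (homeo_iter h (Num.floor w) z, w - (Num.floor w)%:~R).
  by exists (Num.floor w); rewrite /= subrK.
move=> /eqquotP /asboolP /gluedE /(Etrans _ _ _ (norm x u)) E1.
exact: Etrans E1 (Esym _ _ (norm y v)).
Qed.

(** The floor jumps at integers, so continuity is patched together: [g k] is continuous everywhere
    and agrees with [susp_point] on the closed strip k <= u <= k + 1. Near (x, u) with k the floor
    of u, only the strips k - 1 and k occur. *)
Lemma susp_point_continuous : continuous (fun p : X * R => susp_point p.1 p.2).
Proof.
have frac_clamp (v : R) : Num.min (Num.max v 0) 1 \in @unit_interval R.
  rewrite inE /unit_interval /= in_itv /=.
  by rewrite ge_min lexx orbT le_min ler01 le_max lexx orbT.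
pose clamp (v : R) : set_type (@unit_interval R) := SigSub (frac_clamp v).
have clamp_cont : continuous clamp.
  apply: continuous_comp_initial => v.
  apply: (@continuous_comp _ _ _ (fun v : R => Num.max v 0) (fun v => Num.min v 1)).
    by apply: (@continuous_max R R id (cst 0)); [exact: cvg_id|exact: cvg_cst].
  by apply: (@continuous_min R R id (cst 1)); [exact: cvg_id|exact: cvg_cst].
pose g (k : int) (p : X * R) : S :=
  \pi_S (homeo_iter h k p.1, clamp (p.2 - k%:~R)).
have g_cont k : continuous (g k).
  apply: (@continuous_fun_comp _ (cylinder R X)); last exact: pi_continuous.
  apply: continuous_pair.
    exact: (@continuous_fun_comp _ _ _ fst (homeo_iter h k)
      (@continuous_fst X R) (@homeo_iter_continuous _ h k)).
  apply: (@continuous_fun_comp _ _ _ (fun p : X * R => p.2 - k%:~R)) clamp_cont.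
  by move=> p; apply: cvgB; [exact: cvg_snd|exact: cvg_cst].
have gE k x u : k%:~R <= u <= (k + 1)%:~R -> g k (x, u) = susp_point x u.
  move=> /andP[ku uk]; rewrite intrD in uk.
  rewrite /g susp_point_pi /= -susp_pointDz; congr susp_point.
  rewrite max_l ?subr_ge0// min_l ?subrK// lerBlDl.
  exact: uk.
move=> [x u]; set k := Num.floor u.
have /andP[ku uk1] : k%:~R <= u < (k + 1)%:~R := floor_itv u.
move=> U; rewrite /= => U_nbhs.
have Pk : nbhs (x, u) (g k @^-1` U).
  by apply: g_cont; rewrite gE // ku ltW.
have Pk' : nbhs (x, u) [set p | p.2 < k%:~R -> p.2 >= (k - 1)%:~R -> U (g (k - 1) p)].
  (* The strip k - 1 touches (x, u) only if u = k; if u > k, a neighborhood avoids it. *)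
  move: ku; rewrite le_eqVlt => /orP[/eqP ku|ku].
    have : nbhs (x, u) (g (k - 1) @^-1` U).
      apply: g_cont; rewrite gE // subrK -ku lexx andbT ler_int; lia.
    by apply: filterS => p /= Up _ _.
  have : nbhs (x, u) [set p : X * R | k%:~R < p.2].
    apply: (@continuous_snd X R (x, u) [set v : R | k%:~R < v]).
    exact: lt_nbhsr.
  by apply: filterS => p /= /lt_trans h1 /h1; rewrite ltxx.
have Pitv : nbhs (x, u) [set p : X * R | (k - 1)%:~R < p.2 < (k + 1)%:~R].
  apply: (@continuous_snd X R (x, u) [set v : R | (k - 1)%:~R < v < (k + 1)%:~R]).
  have -> : [set v : R | (k - 1)%:~R < v < (k + 1)%:~R] =
     `](k-1)%:~R, (k+1)%:~R[%classic by apply/seteqP; split=> v /=; rewrite in_itv.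
  apply: near_in_itvoo; rewrite in_itv /= uk1 andbT (lt_le_trans _ ku)// ltr_int; lia.
apply: filterS (filterI Pk (filterI Pk' Pitv)) => -[y v] /= [Uk [Uk1 /andP[kv vk]]].
have [kv'|vk'] := leP k%:~R v.
  by rewrite -(gE k) // kv' ltW.
rewrite -(gE (k - 1)); last by rewrite subrK (ltW kv) ltW.
exact: Uk1 (ltW kv).
Qed.

End SuspensionPoint.

(** * Separation by real functions, and embeddings of compact sets *)

Lemma separating_hausdorff (R : realType) (T : topologicalType) :
  (forall p q : T, (forall f : T -> R, continuous f -> f p = f q) -> p = q) ->
  hausdorff_space T.
Proof.
move=> sep p q pq; apply: sep => f cf; apply: Rhausdorff => A B fpA fqB.
have [x [Ax Bx]] := pq _ _ (cf _ _ fpA) (cf _ _ fqB).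
by exists (f x).
Qed.

(** The inverse is continuous because [f] is closed on [A]: for [V] open, [A] minus [V] is compact,
    so its image is compact, hence closed in [U]. *)
Lemma compact_image_homeomorphic (T U : topologicalType) (f : T -> U)
    (A : set T) :
  continuous f -> injective f -> hausdorff_space U -> compact A ->
  homeomorphic (set_type (f @` A)) (set_type A).
Proof.
move=> cf injf hU cA.
have fP (x : set_type A) : f (\val x) \in f @` A.
  by rewrite inE; exists (\val x) => //; exact: set_mem (valP x).
have gP (y : set_type (f @` A)) : exists x : set_type A, f (\val x) = \val y.
  by have /set_mem[x Ax <-] := valP y; exists (SigSub (mem_set Ax)).
pose F x : set_type (f @` A) := SigSub (fP x).
pose G y : set_type A := sval (cid (gP y)).
have GP y : f (\val (G y)) = \val y by rewrite /G; case: cid.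
have GK : cancel G F by move=> y; apply: val_inj; exact: GP.
have FK : cancel F G by move=> x; apply/val_inj/injf; exact: GP.
have cG : continuous G.
  apply/continuousP => _ [V oV <-].
  exists (~` (f @` (A `\` V))).
    apply: closed_openC; apply: compact_closed => //.
    apply: continuous_compact; first exact: continuous_subspaceT.
    by apply: (compact_closedI cA); exact: open_closedC.
  apply/seteqP; split => y /= yP.
    apply: contrapT => nV; apply: yP; exists (\val (G y)); last exact: GP.
    by split => //; exact: set_mem (valP (G y)).
  by move=> [a [Aa nVa]]; rewrite -[X in _ = X]GP => /injf aG; apply: nVa; rewrite aG.
have cF : continuous F.
  apply: continuous_comp_initial.
  exact: (@continuous_fun_comp _ _ _ _ f (@initial_continuous _ _ _) cf).
by constructor; exists G F.
Qed.

(** * The suspension flow; compactness and separation of the suspension *)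

Section SuspensionFlow.
Variables (R : realType) (X : topologicalType) (h : homeomorphism X X).
Local Notation S := (suspension R h).

Lemma suspension_flow0 (q : S) : suspension_flow 0 q = q.
Proof. by have [x [u [_ _ ->]]] := susp_pointP q; rewrite flow_susp_point addr0. Qed.

Lemma suspension_flowD (s t : R) (q : S) :
  suspension_flow s (suspension_flow t q) = suspension_flow (t + s) q.
Proof.
by have [x [u [_ _ ->]]] := susp_pointP q; rewrite !flow_susp_point addrA.
Qed.

(** One inclusion is enough, since time - t undoes time t. *)
Lemma flow_invariantP (A : set S) :
  flow_invariant A <-> forall t q, A q -> A (suspension_flow t q).
Proof.
split=> [inv t q Aq|inv t]; first by rewrite -(inv t); exists q.
apply/seteqP; split=> [_ [q Aq <-]|q Aq]; first exact: inv.
exists (suspension_flow (- t) q); first exact: inv.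
by rewrite suspension_flowD addNr suspension_flow0.
Qed.

Lemma suspension_compact : compact [set: X] -> compact [set: S].
Proof.
move=> cX; rewrite (_ : [set: S] =
    (fun p : X * R => susp_point h p.1 p.2) @` ([set: X] `*` `[0, 1]%classic)).
  apply: continuous_compact.
    by apply: continuous_subspaceT; exact: susp_point_continuous.
  exact: compact_setX cX (@segment_compact _ 0 1).
apply/seteqP; split => // q _; have [x [u [u0 u1 ->]]] := susp_pointP q.
by exists (x, u) => //; split => //=; rewrite in_itv /= u0 ltW.
Qed.

(** This is the source of the real functions that separate points of the suspension. The boundary
    condition says that [phi] respects the gluing; heights in [0, 1[ reach every point. *)
Lemma suspension_lift (phi : X -> R -> R) :
  (forall x, phi x 1 = phi (h x) 0) ->
  continuous (fun p : X * R => phi p.1 p.2) ->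
  exists f : S -> R, continuous f /\
    forall x u, 0 <= u < 1 -> f (susp_point h x u) = phi x u.
Proof.
move=> phi01 cphi; pose c (p : cylinder R X) := phi p.1 (\val p.2).
have cE p q : clos_refl_sym_trans _ (@Defs.glue R X h) p q -> c p = c q.
  elim=> {p q} [p q [p1 q0 pq]|//|//|p q r _ -> //].
  by rewrite /c p1 q0 pq phi01.
have c_repr p : c (repr (\pi_S p)) = c p.
  apply: cE; apply/asboolP.
  by have /eqquotP : repr (\pi_S p) = p %[mod S] by rewrite reprK.
exists (fun q => c (repr q)); split.
  apply/quotient_continuous; rewrite (_ : _ \o _ = c); last exact/funext.
  apply: (@continuous_fun_comp _ _ _
    (fun p : cylinder R X => (p.1, \val p.2)) _ _ cphi).
  apply: continuous_pair; first exact: continuous_fst.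
  apply: (@continuous_fun_comp _ _ _ snd (fun s : set_type _ => \val s)).
    exact: continuous_snd.
  exact: initial_continuous.
move=> x u /andP[u0 u1].
have uI : u \in @unit_interval R.
  by rewrite inE /unit_interval /= in_itv /= u0 ltW.
by rewrite -[susp_point h x u](susp_point_pi h (x, SigSub uI : set_type _)) c_repr.
Qed.

(** Functions of the height alone recover the height. Weights depending on the height then turn each
    function on [X] into one that respects the gluing, and these recover the base point. *)
Lemma suspension_hausdorff :
  (forall x y : X, (forall f : X -> R, continuous f -> f x = f y) -> x = y) ->
  hausdorff_space S.
Proof.
move=> sepX; apply: (@separating_hausdorff R) => p q.
have [x [u [u0 u1 ->]]] := susp_pointP p.
have [y [v [v0 v1 ->]]] := susp_pointP q => sep.
have phiE (phi : X -> R -> R) : (forall x, phi x 1 = phi (h x) 0) ->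
    continuous (fun p : X * R => phi p.1 p.2) -> phi x u = phi y v.
  move=> phi01 /(suspension_lift phi01)[f [cf fE]].
  by rewrite -!fE ?u0 ?v0 //; exact: sep.
have id_cont : continuous (fun p : X * R => p.2) by exact: continuous_snd.
have sub_cont : continuous (fun p : X * R => 1 - p.2).
  by move=> r; apply: cvgB; [exact: cvg_cst|exact: id_cont].
have bump_cont : continuous (fun p : X * R => p.2 * (1 - p.2)).
  by move=> r; apply: cvgM; [exact: id_cont|exact: sub_cont].
(* u (1 - u) determines u up to u |-> 1 - u, and the odd factor 1 - 2 u
   resolves this ambiguity; both functions vanish at the glued ends 0 and 1. *)
have uv : u = v.
  have e1 : u * (1 - u) = v * (1 - v).
    by apply: (phiE (fun _ u => u * (1 - u))) => // z; ring.
  have e2 : u * (1 - u) * (1 - 2 * u) = v * (1 - v) * (1 - 2 * v).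
    apply: (phiE (fun _ u => u * (1 - u) * (1 - 2 * u))) => [z|]; first by ring.
    move=> r; apply: cvgM; first exact: bump_cont.
    apply: cvgB; first exact: cvg_cst.
    by apply: cvgM; [exact: cvg_cst|exact: id_cont].
  have [//|/eqP uv] := eqVneq u v.
  have e3 : v = 1 - u.
    have : (u - v) * (1 - u - v) = 0 by nra.
    by move=> /eqP; rewrite mulf_eq0 => /orP[] /eqP; lra.
  (* With v = 1 - u, [e2] equates the odd function with its negative. The roots 0 and 1 contradict v
     < 1 and u < 1, and the root 1/2 gives u = v. *)
  have : u * ((1 - u) * (1 - 2 * u)) = 0 by rewrite e3 in e2; nra.
  move=> /eqP; rewrite !mulf_eq0 => /or3P[] /eqP ?; lra.
rewrite uv; congr susp_point; apply: sepX => f cf.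
have cfst : continuous (fun p : X * R => f p.1).
  exact: (@continuous_fun_comp _ _ _ fst f (@continuous_fst _ _)).
have chfst : continuous (fun p : X * R => f (h p.1)).
  apply: (@continuous_fun_comp _ _ _ (fun p => h p.1) f) cf.
  exact: (@continuous_fun_comp _ _ _ fst h (@continuous_fst _ _)
    (@homeo_fun_continuous _ _ h)).
(* At height 0 the weight u (1 - u) vanishes, so f x is interpolated linearly to f (h x) instead. *)
have [v_eq0|v_neq0] := eqVneq v 0.
  have : (1 - u) * f x + u * f (h x) = (1 - v) * f y + v * f (h y).
    apply: (phiE (fun x u => (1 - u) * f x + u * f (h x))) => [z|]; first by ring.
    by move=> r; apply: cvgD; apply: cvgM;
      [exact: sub_cont|exact: cfst|exact: id_cont|exact: chfst].
  by rewrite uv v_eq0; lra.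
have : u * (1 - u) * f x = v * (1 - v) * f y.
  apply: (phiE (fun x u => u * (1 - u) * f x)) => [z|]; first by ring.
  by move=> r; apply: cvgM; [exact: bump_cont|exact: cfst].
by rewrite uv; apply: mulfI; rewrite mulf_neq0 // subr_eq0 gt_eqF.
Qed.

End SuspensionFlow.

(** * Maps of suspensions induced by maps that turn [h] into the L-th power of [g] *)

Section SuspensionMap.
Variables (R : realType) (X Y : topologicalType).
Variables (h : homeomorphism X X) (g : homeomorphism Y Y).
Variables (f : X -> Y) (L : nat).
Hypothesis f_equiv : forall x, f (h x) = homeo_iter g L (f x).
Local Notation S := (suspension R h).

(** The choice made by [repr] is immaterial, by equivariance: see [susp_map_point]. *)
Definition susp_map (q : S) : suspension R g :=
  susp_point g (f (repr q).1) (L%:R * \val (repr q).2).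

Lemma equivariant_iter (k : int) x :
  f (homeo_iter h k x) = homeo_iter g (L%:Z * k) (f x).
Proof.
move: k x; apply: int_step_ind => [x|k]; first by rewrite mulr0.
split=> IH x; first by rewrite homeo_iterS IH f_equiv -homeo_iterD mulrDr mulr1.
rewrite -[x](homeo_invK h) -homeo_iterS IH f_equiv -homeo_iterD.
by rewrite mulrDr mulr1.
Qed.

Lemma susp_map_point x (u : R) :
  susp_map (susp_point h x u) = susp_point g (f x) (L%:R * u).
Proof.
set q := susp_point h x u; rewrite /susp_map.
have : susp_point h (repr q).1 (\val (repr q).2) = susp_point h x u.
  by rewrite -susp_point_pi reprK.
move=> /susp_point_eq[k [-> ->]].
by rewrite equivariant_iter mulrDr -susp_pointDz intrM.
Qed.

Lemma susp_map_flow t (q : S) :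
  susp_map (suspension_flow t q) = suspension_flow (L%:R * t) (susp_map q).
Proof.
have [x [u [_ _ ->]]] := susp_pointP q.
by rewrite flow_susp_point !susp_map_point flow_susp_point mulrDr.
Qed.

Lemma susp_map_continuous : continuous f -> continuous susp_map.
Proof.
move=> cf; apply/quotient_continuous; rewrite (_ : _ \o _ =
    fun p : cylinder R X => susp_point g (f p.1) (L%:R * \val p.2)).
  apply: (@continuous_fun_comp _ _ _
    (fun p : cylinder R X => (f p.1, L%:R * \val p.2)) _ _
    (@susp_point_continuous R Y g)).
  apply: continuous_pair.
    exact: (@continuous_fun_comp _ _ _ fst f (@continuous_fst _ _)).
  move=> p; apply: cvgM; first exact: cvg_cst.
  apply: (@continuous_fun_comp _ _ _ snd (fun s : set_type _ => \val s)).
    exact: continuous_snd.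
  exact: initial_continuous.
by apply/funext => p /=; rewrite susp_point_pi susp_map_point.
Qed.

(** Points with equal images have codes f x and f y that differ by some power g^k. Recognizability
    gives k = L m, so f y = f (h^m x), and y = h^m x by injectivity. *)
Lemma susp_map_inj : (0 < L)%N -> injective f ->
  (forall k x y, f y = homeo_iter g k (f x) -> (L %| k)%Z) ->
  injective susp_map.
Proof.
move=> L0 injf recog p q.
have [x [u [_ _ ->]]] := susp_pointP p.
have [y [v [_ _ ->]]] := susp_pointP q.
rewrite !susp_map_point => /susp_point_eq[k [fy uv]].
have /dvdzP[m km] := recog _ _ _ fy.
have -> : y = homeo_iter h m x.
  by apply: injf; rewrite fy km equivariant_iter mulrC.
rewrite -susp_pointDz; congr susp_point.
have L0' : (L%:R : R) != 0 by rewrite pnatr_eq0 -lt0n.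
by apply: (mulfI L0'); rewrite uv km intrM mulrDr [m%:~R * _]mulrC.
Qed.

(** Time t on the image is time t / L on [M], so the image is invariant. A non-empty closed
    invariant subset of it pulls back to one of [M], hence to all of [M]. *)
Lemma susp_map_minimal (M : set S) : (0 < L)%N ->
  continuous susp_map -> injective susp_map ->
  compact [set: S] -> hausdorff_space (suspension R g) ->
  minimal_set M -> minimal_set (susp_map @` M) /\
    homeomorphic (set_type (susp_map @` M)) (set_type M).
Proof.
move=> L0 cF injF cS hS' [M0 Mcl Minv Mmin].
have cM : compact M by apply: (subclosed_compact Mcl cS).
split; last exact: compact_image_homeomorphic.
split.
- by have [q Mq] := M0; exists (susp_map q), q.
- apply: compact_closed => //; apply: continuous_compact => //.
  exact: continuous_subspaceT.
- apply/flow_invariantP => t _ [q Mq <-].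
  exists (suspension_flow (t / L%:R) q).
    by move/flow_invariantP : Minv; exact.
  by rewrite susp_map_flow mulrC divfK // pnatr_eq0 -lt0n.
move=> B [b Bb] Bcl /flow_invariantP Binv BM.
have [p Mp Fp] := BM _ Bb; apply/seteqP; split => // _ [q Mq <-].
suff MB : M `&` susp_map @^-1` B = M by move: Mq; rewrite -{1}MB => -[].
apply: Mmin; [| | |exact: subIsetl].
- by exists p; split => //=; rewrite Fp.
- by apply: closedI => //; move/continuous_closedP : cF; exact.
apply/flow_invariantP => t r [Mr Br]; split.
  by move/flow_invariantP : Minv; exact.
by rewrite /= susp_map_flow; exact: Binv.
Qed.

End SuspensionMap.

(** * Topology of the full shift *)

Section ShiftSpace.
Variable n : nat.
Local Notation X := (shift_space n).

Lemma iter_shiftE (k : int) (x : X) (i : int) :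
  homeo_iter (Defs.shift n) k x i = x (i + k).
Proof.
move: k x i; apply: int_step_ind => [x i|k]; first by rewrite addr0.
split=> IH x i; first by rewrite homeo_iterS IH /= /shift_fun -addrA.
rewrite -[x](homeo_invK (Defs.shift n)) -homeo_iterS IH /= /shift_fun /shift_inv.
by rewrite addrA.
Qed.

Lemma shift_space_cvg (F : set_system X) (x : X) : Filter F ->
  (forall i : int, F [set y | y i = x i]) -> F --> x.
Proof.
move=> FF Fx; apply/cvg_sup => i U [V] [[W oW <-] Wx WU].
by apply: filterS (Fx i) => y yx; apply: WU; rewrite /= yx.
Qed.

Lemma coordinate_nbhs (x : X) (i : int) : nbhs x [set y : X | y i = x i].
Proof.
apply: (@proj_continuous int (fun=> discrete_topology 'I_n) i x [set x i]).
by apply: open_nbhs_nbhs; split => //; exact: discrete_open.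
Qed.

Lemma shift_space_compact : compact [set: X].
Proof.
rewrite (_ : [set: X] = [set x | forall i, [set: discrete_topology 'I_n] (x i)]).
  apply: (@tychonoff int (fun=> discrete_topology 'I_n) (fun=> setT)) => i.
  by apply: finite_compact; exact: finite_finset.
by apply/seteqP; split.
Qed.

(** Indicators of one symbol at one coordinate are continuous and separate sequences. *)
Lemma shift_space_separated (R : realType) (x y : X) :
  (forall f : X -> R, continuous f -> f x = f y) -> x = y.
Proof.
move=> sep; apply/funext => i.
have /= : ((x i == x i)%:R : R) = (y i == x i)%:R.
  apply: (sep (fun z : X => (z i == x i)%:R)) => z U Uz.
  apply: filterS (coordinate_nbhs z i) => w wz /=.
  by rewrite [w i]wz; exact: nbhs_singleton Uz.
by rewrite eqxx; case: eqP => [->//|_] /eqP; rewrite oner_eq0.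
Qed.

End ShiftSpace.

(** * A constant-length substitution and the recognition of its blocks *)

Section MarkedBlockCode.
Variables (n L : nat) (u : int -> 'I_n).
Local Notation X := (shift_space n).

(* The substitution a |-> u 0 ... u (L - 2) a; other values of u are unused. *)
Definition block_code (x : X) : X := fun i =>
  if (i %% L)%Z == L%:Z - 1 then x (i %/ L)%Z else u (i %% L)%Z.

Lemma block_code_prefix (x : X) (j q : int) : 0 <= j < L%:Z - 1 ->
  block_code x (q * L%:Z + j) = u j.
Proof.
move=> jL; rewrite /block_code modzMDl modz_small; last by lia.
by rewrite ifF //; apply/eqP; lia.
Qed.

Lemma block_code_letter (x : X) (q : int) : (0 < L)%N ->
  block_code x (q * L%:Z + (L%:Z - 1)) = x q.
Proof.
move=> L0; rewrite /block_code modzMDl modz_small; last by lia.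
rewrite eqxx divzMDl; last by lia.
by rewrite divz_small ?addr0 //; lia.
Qed.

Lemma block_code_shift (x : X) : (0 < L)%N ->
  block_code (Defs.shift n x) = homeo_iter (Defs.shift n) L (block_code x).
Proof.
move=> L0; apply/funext => i; rewrite iter_shiftE /block_code modzDr.
by rewrite divzDr ?dvdzz // divzz /= /shift_fun; have -> : L != 0 by lia.
Qed.

Lemma block_code_inj : (0 < L)%N -> injective block_code.
Proof.
move=> L0 x y xy; apply/funext => q.
by rewrite -block_code_letter // xy block_code_letter.
Qed.

Lemma block_code_continuous : continuous block_code.
Proof.
move=> x; apply: shift_space_cvg => [|i].
  exact: (fmap_filter block_code (nbhs_filter x)).
apply: (@filterS _ (nbhs x) _ _ (block_code @^-1` _) _
  (coordinate_nbhs x (i %/ L)%Z)).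
by move=> y /= yx; rewrite /block_code yx.
Qed.

(* The run of a's of length m preceding b prevents u from having a period
   at most L / 2, whereas two codings offset by k, where L does not divide k,
   force both k mod L and - k mod L to be periods. *)
Lemma block_code_sync (m : nat) (a b : 'I_n) :
  (L <= m.*2)%N -> (m.+2 <= L)%N -> a != b ->
  (forall j : int, L%:Z - 2 - m%:Z <= j < L%:Z - 2 -> u j = a) ->
  u (L%:Z - 2) = b ->
  forall (k : int) x y,
    block_code y = homeo_iter (Defs.shift n) k (block_code x) -> (L %| k)%Z.
Proof.
move=> Lm mL ab ua ub k x y yx.
have {}yx i : block_code y i = block_code x (i + k) by rewrite yx iter_shiftE.
have L0 : L%:Z != 0 by lia.
have := divz_eq k L; have := modz_ge0 k L0; have := @ltz_pmod k L.
set d := (k %% L)%Z; set q := (k %/ L)%Z => dL d0 kE.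
apply/dvdz_mod0P; rewrite -/d; apply: contra_neq_eq ab => d_neq0.
have [dm|md] := leP d m%:Z.
  have := yx (0 * L%:Z + (L%:Z - 2 - d)).
  rewrite block_code_prefix ?ua; [|lia|lia].
  rewrite (_ : _ + k = q * L%:Z + (L%:Z - 2)); last by lia.
  by rewrite block_code_prefix ?ub //; lia.
(* If d > m, the b of a block of y faces position d - 2 of the next block of x; it lies in the run
   of a's because L - m <= m < d. *)
have := yx (0 * L%:Z + (L%:Z - 2)).
rewrite block_code_prefix ?ub; last by lia.
rewrite (_ : _ + k = (q + 1) * L%:Z + (d - 2)); last by lia.
by rewrite block_code_prefix ?ua //; lia.
Qed.

End MarkedBlockCode.

(** * Codes whose blocks carry a window of a given sequence, and density *)

Section DenseCopies.
Variables (R : realType) (n : nat).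
Local Notation X := (shift_space n).

(* The word x_(-r) ... x_r a^(2 r + 3) b, of length 4 r + 5: with the appended
   letter, the run of a's is half of a block. *)
Definition window_block (a b : 'I_n) (x : X) (r : nat) (j : int) : 'I_n :=
  if j < (r.*2.+1)%:Z then x (j - r%:Z)
  else if j == (4 * r + 4)%N then b else a.

Definition window_code a b x r : X -> X :=
  block_code (4 * r + 6) (window_block a b x r).

(** Block 0 of the code starts with x_(-r) ... x_r, so shifting by r puts x_0 at index 0 and gives
    agreement with x on [-r, r], whatever z is. *)
Lemma window_code_cvg (a b : 'I_n) (x z : X) :
  homeo_iter (Defs.shift n) r%:Z (window_code a b x r z) @[r --> \oo] --> x.
Proof.
apply: shift_space_cvg => i.
apply: (@filterS nat \oo _ [set r | (absz i <= r)%N]); last exact: nbhs_infty_ge.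
move=> r /= ir.
rewrite -[LHS]/(homeo_iter (Defs.shift n) r (window_code a b x r z) i).
rewrite iter_shiftE /window_code.
rewrite -[i + r%:Z]add0r -(mul0r (4 * r + 6)%N%:Z) block_code_prefix; last by lia.
by rewrite /window_block addrK ifT //; lia.
Qed.

Lemma window_map_inj (a b : 'I_n) (x : X) (r : nat) : a != b ->
  injective (@susp_map R _ _ (Defs.shift n) (Defs.shift n)
    (window_code a b x r) (4 * r + 6)).
Proof.
move=> ab; apply: susp_map_inj => [y|//||].
- by apply: block_code_shift; lia.
- by lia.
- by apply: block_code_inj; lia.
(* Here L = 4 r + 6 = 2 m: the run of a's fills positions 2 r + 1 to 4 r + 3, and b stands at 4 r +
   4 = L - 2. *)
apply: (@block_code_sync _ _ _ (2 * r + 3) a b) => //; [lia|lia| |].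
- move=> j jr; rewrite /window_block ifF; last by lia.
  by rewrite ifF //; apply/eqP; lia.
- by rewrite /window_block ifF ?ifT //; [apply/eqP; lia|lia].
Qed.

Lemma Sigma_compact : compact [set: Sigma R n].
Proof. exact/suspension_compact/shift_space_compact. Qed.

Lemma Sigma_hausdorff : hausdorff_space (Sigma R n).
Proof. by apply: suspension_hausdorff; exact: shift_space_separated. Qed.

End DenseCopies.

Theorem theorem4p1 (R : realType) (n : nat) (M : set (Sigma R n)) :
  minimal_set M ->
  dense (\bigcup_(N in [set N : set (Sigma R n) |
                          minimal_set N /\
                          homeomorphic (set_type N) (set_type M)]) N).
Proof.
move=> Mmin U [q Uq] oU; have [x [s [_ _ qE]]] := susp_pointP q.
have [[p Mp] _ Minv _] := Mmin.
have [z [v [_ _ pE]]] := susp_pointP p; rewrite {}pE in Mp.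
have Uxs : nbhs (x, s)
    [set y : shift_space n * R | U (susp_point (Defs.shift n) y.1 y.2)].
  apply: susp_point_continuous; apply: open_nbhs_nbhs; split => //=.
  by rewrite -qE.
have [n_le1|n_gt1] := leqP n 1.
  have zx : z = x.
    apply/funext => i; apply: ord_inj.
    by have := ltn_ord (z i); have := ltn_ord (x i); lia.
  exists q; split => //; exists M.
    split => //; constructor; apply: (@Homeomorphism _ _ id id) => // t;
      exact: cvg_id.
  have -> : q = suspension_flow (s - v) (susp_point (Defs.shift n) z v).
    by rewrite flow_susp_point qE zx addrC subrK.
  by move/flow_invariantP : Minv; exact.
pose a : 'I_n := Ordinal (ltnW n_gt1); pose b : 'I_n := Ordinal n_gt1.
have ab : a != b by [].
(* The shifted codes of z tend to x while the height stays s, so they eventually enter the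
   neighborhood [Uxs]. *)
have [r Ur] : exists r : nat, U (susp_point (Defs.shift n)
    (homeo_iter (Defs.shift n) r (window_code a b x r z)) s).
  apply: (@filter_ex _ \oo).
  exact: (cvg_pair (@window_code_cvg n a b x z) (@cvg_cst _ s _ \oo _) Uxs).
set L := (4 * r + 6)%N; pose f := window_code a b x r.
pose F := @susp_map R _ _ (Defs.shift n) (Defs.shift n) f L.
have L0 : (0 < L)%N by rewrite /L; lia.
have f_equiv y : f (Defs.shift n y) = homeo_iter (Defs.shift n) L (f y).
  exact: block_code_shift.
have [Nmin NM] : minimal_set (F @` M) /\
    homeomorphic (set_type (F @` M)) (set_type M).
  apply: susp_map_minimal => //.
  - by apply: susp_map_continuous => //; exact: block_code_continuous.
  - exact: window_map_inj.
  - exact: Sigma_compact.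
  - exact: Sigma_hausdorff.
exists (susp_point (Defs.shift n) (homeo_iter (Defs.shift n) r (f z)) s).
split; first exact: Ur.
exists (F @` M) => //.
have [_ _ /flow_invariantP Ninv _] := Nmin.
(* [F] sends the point (z, v) to (f z, L v). The flow time brings the height to s + r, and the r
   full units become r shifts. *)
have -> : susp_point (Defs.shift n) (homeo_iter (Defs.shift n) r (f z)) s =
    suspension_flow (s + r%:R - L%:R * v) (F (susp_point (Defs.shift n) z v)).
  rewrite /F susp_map_point // flow_susp_point -susp_pointDz.
  by congr susp_point; ring.
by apply: Ninv; exists (susp_point (Defs.shift n) z v).
Qed.
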